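(* Consider $K$ arms, each a two-state irreducible Markov chain $M_i$ on $\{0,1\}$ with transition probabilities $p_{01}^i,p_{10}^i$ and stationary distribution $\pi_i=(\pi_i(0),\pi_i(1))$, rested (only the played arm changes state), with reward $r(s)=s$ when an arm in state $s$ is played. Let $\mu_i=\pi_i(1)$, assume arm 1 is optimal ($\mu_1=\max_j\mu_j$), and $\Delta_i=\mu_1-\mu_i$. Let $\alpha$ be a uniformly good policy. Then $\liminf_{n\to\infty}\frac{R_\alpha(n)}{\log n}\ge\sum_{i=2}^K\frac{\Delta_i}{I(M_i\|M_1)}$, where $I(M_i\|M_j)=\pi_i(0)D(p_{01}^i\|p_{01}^j)+\pi_i(1)D(p_{10}^i\|p_{10}^j)$.
   Context: $D(a\|b)=a\log\frac ab+(1-a)\log\frac{1-a}{1-b}$. A policy $\alpha$ chooses at each time $t$ an arm $\alpha(t)$ based on past choices and rewards; its regret is $R_\alpha(n)=n\mu_1-\mathbb E_\alpha\big[\sum_{t=1}^n r(s(\alpha(t)))\big]$, where $s(\alpha(t))$ is the state of the chosen arm at time $t$. The policy is uniformly good if, for every such bandit instance (every choice of irreducible two-state chains for the arms), $R_\alpha(n)=o(n^\beta)$ for every $\beta>0$. *)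

(* Defs.v *)
From HB Require Import structures.
From mathcomp Require Import all_boot all_order all_algebra.
From mathcomp Require Import all_classical all_reals all_analysis.
Set Implicit Arguments. Unset Strict Implicit. Unset Printing Implicit Defensive.
Import Order.TTheory GRing.Theory Num.Theory.
Local Open Scope ring_scope.
Local Open Scope classical_set_scope.

Section MarkovBandit.
Variable R : realType.
Variable K : nat.

(* A history: the sequence of (chosen arm, observed reward) pairs so far.
   Since r(s) = s, the observed reward is the observed state of the arm. *)
Definition history := seq ('I_K * bool).

Definition policy := history -> 'I_K -> R.

Definition is_policy (alpha : policy) : Prop :=
  forall h, (forall a, 0 <= alpha h a) /\ \sum_(a < K) alpha h a = 1.

Definition irreducible2 (p01 p10 : R) : Prop :=
  0 < p01 <= 1 /\ 0 < p10 <= 1.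

Definition trans2 (p01 p10 : R) (s s' : bool) : R :=
  match s, s' with
  | false, true => p01
  | false, false => 1 - p01
  | true, false => p10
  | true, true => 1 - p10
  end.

Definition pi1 (p01 p10 : R) : R := p01 / (p01 + p10).
Definition pi0 (p01 p10 : R) : R := p10 / (p01 + p10).

Definition last_obs (h : history) (a : 'I_K) : option bool :=
  foldl (fun acc p => if p.1 == a then Some p.2 else acc) None h.

(* Rested dynamics: the state of arm a when played equals its initial state
   x0 a if never played before; otherwise it is obtained from the state it
   had at its last play by one transition of its chain (only played arms
   move). Probability that playing arm a after history h yields state y. *)
Definition obs_prob (p01 p10 : 'I_K -> R) (x0 : 'I_K -> bool)
    (h : history) (a : 'I_K) (y : bool) : R :=
  match last_obs h a with
  | None => (y == x0 a)%:R
  | Some s => trans2 (p01 a) (p10 a) s y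
  end.

Fixpoint exp_reward (p01 p10 : 'I_K -> R) (x0 : 'I_K -> bool)
    (alpha : policy) (h : history) (m : nat) : R :=
  match m with
  | 0 => 0
  | m'.+1 => \sum_(a < K) alpha h a *
      \sum_(y : bool) obs_prob p01 p10 x0 h a y *
        ((y : nat)%:R + exp_reward p01 p10 x0 alpha (rcons h (a, y)) m')
  end.

Definition mu (p01 p10 : 'I_K -> R) (i : 'I_K) : R := pi1 (p01 i) (p10 i).

Definition mu_star (p01 p10 : 'I_K -> R) : R :=
  \big[Num.max/0]_(j < K) mu p01 p10 j.

Definition regret (p01 p10 : 'I_K -> R) (x0 : 'I_K -> bool)
    (alpha : policy) (n : nat) : R :=
  n%:R * mu_star p01 p10 - exp_reward p01 p10 x0 alpha [::] n.

Definition uniformly_good (x0 : 'I_K -> bool) (alpha : policy) : Prop :=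
  forall p01 p10 : 'I_K -> R,
    (forall i, irreducible2 (p01 i) (p10 i)) ->
    forall beta : R, 0 < beta ->
      (fun n : nat => regret p01 p10 x0 alpha n / powR (n%:R) beta)
        @ \oo --> 0%R.

Local Open Scope ereal_scope.

Definition xlogxy (a b : R) : \bar R :=
  if a == 0%R then 0 else if b == 0%R then +oo else (a * ln (a / b))%:E.

Definition klD (a b : R) : \bar R := xlogxy a b + xlogxy (1 - a) (1 - b).

Definition klI (p01 p10 : 'I_K -> R) (i j : 'I_K) : \bar R :=
  (pi0 (p01 i) (p10 i))%:E * klD (p01 i) (p01 j)
  + (pi1 (p01 i) (p10 i))%:E * klD (p10 i) (p10 j).

Definition kl_ratio (d : R) (I : \bar R) : \bar R :=
  if d == 0%R then 0 else
  match I with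
  | r%:E => (d / r)%:E
  | _ => 0
  end.

End MarkovBandit.

(* Main.v *)
Require Import Defs.
From HB Require Import structures.
From mathcomp Require Import all_boot all_order all_algebra.
From mathcomp Require Import all_classical all_reals all_analysis.
From mathcomp Require Import ring lra.
Import Order.TTheory GRing.Theory Num.Theory.
Local Open Scope ring_scope.

Set Implicit Arguments.
Unset Strict Implicit.
Unset Printing Implicit Defensive.

(** By the Poisson equation of each two-state chain, the expected additive cost
    of a policy is, up to a bounded error, the sum over the arms of the stationary
    cost times the expected number of plays [T_i(n)].  Applied to rewards this
    gives [R(n) = \sum_i Delta_i T_i(n) + O(1)]; applied to log-likelihood ratios it
    bounds the divergence between the bandit and one in which the suboptimal arm
    [i] has been made slightly better than arm 1 by [(I(M_i||M_1) + t) T_i(n) + O(1)].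
    Being uniformly good makes arm [i] rare in the first bandit, [T_i(n) = o(n)], and
    omnipresent in the second, [n - T'_i(n) = O(n^b)].  The change of measure
    inequality [E F <= KL + E' e^F - 1], tested on
    [F = (1 - b) (ln n) (1 - N_i/n)] with [N_i] the number of plays of arm [i],
    therefore forces [(1 - b) (ln n) (1 - T_i(n)/n) <= (I(M_i||M_1) + t) T_i(n) + O(1)]. *)

(** * Expected costs of a policy over a finite horizon *)

Section Expectation.
Variables (R : realType) (K : nat) (x0 : 'I_K -> bool) (alpha : policy R K).
Hypothesis alphaP : is_policy alpha.
Implicit Types (p q : 'I_K -> R) (h : history K) (a : 'I_K) (y : bool).
Implicit Types (c : history K -> 'I_K -> bool -> R) (F : history K -> R).
Implicit Types (G : 'I_K -> bool -> R).

(** The history enters [obs_prob] only through the last observation of the arm. Isolating that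
    observation leaves finitely many cases per arm; the two forms are convertible, and proofs pass
    between them freely. *)
Definition arm_prob p01 p10 a (o : option bool) y : R :=
  if o is Some s then trans2 (p01 a) (p10 a) s y else (y == x0 a)%:R.

Definition chains p01 p10 := forall i : 'I_K, @irreducible2 R (p01 i) (p10 i).

Lemma arm_prob_ge0 p01 p10 a o y : chains p01 p10 -> 0 <= arm_prob p01 p10 a o y.
Proof.
move=> /(_ a) [/andP[? ?] /andP[? ?]].
case: o => [[]|] //=; case: y => //=; lra.
Qed.

Lemma arm_prob_sum p01 p10 a o : \sum_(y : bool) arm_prob p01 p10 a o y = 1.
Proof.
rewrite big_bool; case: o => [[]|] /=; try lra.
by case: (x0 a); rewrite /= ?addr0 ?add0r.
Qed.

Definition step p01 p10 h G : R :=
  \sum_(a < K) alpha h a * \sum_(y : bool) obs_prob p01 p10 x0 h a y * G a y.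

Lemma eq_step p01 p10 h G1 G2 : G1 =2 G2 -> step p01 p10 h G1 = step p01 p10 h G2.
Proof. by move=> e; apply: eq_bigr => a _; congr (_ * _); apply: eq_bigr => y _; rewrite e. Qed.

Lemma stepD p01 p10 h G1 G2 :
  step p01 p10 h (fun a y => G1 a y + G2 a y) = step p01 p10 h G1 + step p01 p10 h G2.
Proof.
rewrite /step -big_split; apply: eq_bigr => a _ /=; rewrite -mulrDr -big_split /=.
by congr (_ * _); apply: eq_bigr => y _; rewrite mulrDr.
Qed.

Lemma stepZ p01 p10 h k G :
  step p01 p10 h (fun a y => k * G a y) = k * step p01 p10 h G.
Proof.
rewrite /step mulr_sumr; apply: eq_bigr => a _; rewrite [RHS]mulrCA [k * _]mulr_sumr.
by congr (_ * _); apply: eq_bigr => y _; rewrite mulrCA.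
Qed.

Lemma step_arm p01 p10 h (u : 'I_K -> R) :
  step p01 p10 h (fun a _ => u a) = \sum_(a < K) alpha h a * u a.
Proof.
apply: eq_bigr => a _; rewrite -mulr_suml.
by rewrite [X in _ * (X * _)](arm_prob_sum p01 p10 a (last_obs h a)) mul1r.
Qed.

Lemma step_cst p01 p10 h k : step p01 p10 h (fun _ _ => k) = k.
Proof. by rewrite step_arm -mulr_suml (alphaP h).2 mul1r. Qed.

Lemma ler_step2 p01 p10 q01 q10 h G1 G2 :
    (forall a y, obs_prob p01 p10 x0 h a y * G1 a y <=
                 obs_prob q01 q10 x0 h a y * G2 a y) ->
  step p01 p10 h G1 <= step q01 q10 h G2.
Proof.
move=> le12; apply: ler_sum => a _; apply: ler_wpM2l; first exact: (alphaP h).1.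
exact: ler_sum.
Qed.

Lemma ler_step p01 p10 h G1 G2 : chains p01 p10 ->
  (forall a y, G1 a y <= G2 a y) -> step p01 p10 h G1 <= step p01 p10 h G2.
Proof.
move=> ch le12; apply: ler_step2 => a y; apply: ler_wpM2l => //.
exact: (arm_prob_ge0 a (last_obs h a)).
Qed.

(* [c] is the running cost of a play, [F] the terminal cost of the final history. *)
Fixpoint ecost p01 p10 c F h m : R :=
  if m is m'.+1 then
    step p01 p10 h (fun a y => c h a y + ecost p01 p10 c F (rcons h (a, y)) m')
  else F h.

Definition nocost : history K -> 'I_K -> bool -> R := fun _ _ _ => 0.
Definition noterm : history K -> R := fun _ => 0.

Lemma exp_rewardE p01 p10 h m :
  exp_reward p01 p10 x0 alpha h m =
  ecost p01 p10 (fun _ _ y => (y : nat)%:R) noterm h m.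
Proof.
elim: m h => //= m IH h; apply: eq_step => a y.
by rewrite IH.
Qed.

Lemma eq_ecost p01 p10 c c' F F' h m :
  (forall h a y, c h a y = c' h a y) -> F =1 F' ->
  ecost p01 p10 c F h m = ecost p01 p10 c' F' h m.
Proof.
move=> ec eF; elim: m h => //= m IH h.
by apply: eq_step => a y; rewrite IH ec.
Qed.

Lemma ecost_lin p01 p10 k c F c' F' h m :
  ecost p01 p10 (fun h a y => k * c h a y + c' h a y) (fun h => k * F h + F' h) h m =
  k * ecost p01 p10 c F h m + ecost p01 p10 c' F' h m.
Proof.
elim: m h => //= m IH h; rewrite -stepZ -stepD.
by apply: eq_step => a y; rewrite IH; ring.
Qed.

Lemma ecost0 p01 p10 h m : ecost p01 p10 nocost noterm h m = 0.
Proof.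
elim: m h => //= m IH h.
by rewrite -[RHS](step_cst p01 p10 h); apply: eq_step => a y; rewrite IH addr0.
Qed.

Lemma ler_ecost p01 p10 c c' F F' h m : chains p01 p10 ->
  (forall h a y, c h a y <= c' h a y) ->
  (forall h', size h' = (size h + m)%N -> F h' <= F' h') ->
  ecost p01 p10 c F h m <= ecost p01 p10 c' F' h m.
Proof.
move=> ch lec; elim: m h => [|m IH] h leF /=; first by rewrite leF ?addn0.
apply: ler_step => // a y; apply: lerD => //; apply: IH => h' sh'.
by apply: leF; rewrite sh' size_rcons addSnnS.
Qed.

Lemma ecost_cst p01 p10 k h m : ecost p01 p10 nocost (fun _ => k) h m = k.
Proof.
elim: m h => //= m IH h.
by rewrite -[RHS](step_cst p01 p10 h); apply: eq_step => a y; rewrite IH add0r.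
Qed.

(** The hypothesis averages over the observation only, for each fixed arm, so the policy has no
    influence on the value. *)
Lemma ecost_martingale p01 p10 c F h m :
  (forall h a, \sum_(y : bool) obs_prob p01 p10 x0 h a y *
                 (c h a y + F (rcons h (a, y))) = F h) ->
  ecost p01 p10 c F h m = F h.
Proof.
move=> mart; elim: m h => //= m IH h.
rewrite -[RHS](step_cst p01 p10 h); apply: eq_bigr => a _; congr (_ * _).
rewrite -mulr_suml [X in _ = X * _](arm_prob_sum p01 p10 a (last_obs h a)) mul1r -(mart h a).
by apply: eq_bigr => y _; rewrite IH.
Qed.

(** * Expected numbers of plays *)

Definition plays p01 p10 i (n : nat) : R :=
  ecost p01 p10 (fun _ a _ => (a == i)%:R) noterm [::] n.

Lemma plays_ge0 p01 p10 i n : chains p01 p10 -> 0 <= plays p01 p10 i n.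
Proof.
move=> ch; rewrite -(ecost0 p01 p10 [::] n).
by apply: ler_ecost => // ? ? ? /=; rewrite /nocost ler0n.
Qed.

Lemma ecost_arm p01 p10 (u : 'I_K -> R) n :
  ecost p01 p10 (fun _ a _ => u a) noterm [::] n = \sum_(i < K) u i * plays p01 p10 i n.
Proof.
rewrite /plays; elim: n [::] => [|n IH] h /=.
  by rewrite big1 // => i _; rewrite /noterm mulr0.
under [RHS]eq_bigr => i _ do rewrite -stepZ.
transitivity (step p01 p10 h (fun a y => \sum_(i < K)
  u i * ((a == i)%:R + ecost p01 p10 (fun _ a _ => (a == i)%:R) noterm (rcons h (a, y)) n))).
  apply: eq_step => a y; rewrite IH.
  under [RHS]eq_bigr => i _ do rewrite mulrDr.
  rewrite big_split /=; congr (_ + _).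
  rewrite (bigD1 a) //= eqxx mulr1 big1 ?addr0 // => i /negPf ia.
  by rewrite eq_sym ia mulr0.
rewrite /step exchange_big /=; apply: eq_bigr => a _.
rewrite -mulr_sumr; congr (_ * _).
rewrite exchange_big /=; apply: eq_bigr => y _.
by rewrite mulr_sumr.
Qed.

Lemma sum_plays p01 p10 n : \sum_(i < K) plays p01 p10 i n = n%:R.
Proof.
rewrite -[LHS](eq_bigr _ (fun i _ => mul1r _)) -(ecost_arm p01 p10 (fun=> 1)).
elim: n [::] => //= n IH h.
rewrite -[RHS](step_cst p01 p10 h).
by apply: eq_step => a y; rewrite IH -natr1 addrC.
Qed.

Lemma last_obs_rcons h a y b :
  last_obs (rcons h (a, y)) b = if a == b then Some y else last_obs h b.
Proof. by rewrite /last_obs foldl_rcons. Qed.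

(** * The Poisson equation and stationary costs *)

Implicit Types (g : 'I_K -> option bool -> bool -> R) (o : option bool).

Definition arm_cost g h a y : R := g a (last_obs h a) y.

Definition mean_cost p01 p10 g a o : R :=
  \sum_(y : bool) arm_prob p01 p10 a o y * g a o y.

Definition stat_cost p01 p10 g a : R :=
  pi0 (p01 a) (p10 a) * mean_cost p01 p10 g a (Some false) +
  pi1 (p01 a) (p10 a) * mean_cost p01 p10 g a (Some true).

(** A relative value function for each arm, normalised to vanish in state 0. Subtracting the
    equations of the two states gives the value [w a] in state 1; the value at [None] is then solved
    for, which accounts for the deterministic first observation. *)
Lemma poisson_equation p01 p10 g : chains p01 p10 ->
  exists phi : 'I_K -> option bool -> R, forall a o,
    \sum_(y : bool) arm_prob p01 p10 a o y * (g a o y + phi a (Some y)) =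
    stat_cost p01 p10 g a + phi a o.
Proof.
move=> ch; pose w a := (mean_cost p01 p10 g a (Some true) -
  mean_cost p01 p10 g a (Some false)) / (p01 a + p10 a).
exists (fun a o => match o with
  | Some b => if b then w a else 0
  | None => mean_cost p01 p10 g a None + (if x0 a then w a else 0)
            - stat_cost p01 p10 g a end) => a o.
have [/andP[p0 _] /andP[q0 _]] := ch a.
have pq0 : p01 a + p10 a != 0 by rewrite gt_eqF // addr_gt0.
transitivity (mean_cost p01 p10 g a o +
  \sum_(y : bool) arm_prob p01 p10 a o y * (if y then w a else 0)).
  by rewrite -big_split; apply: eq_bigr => y _ /=; rewrite mulrDr.
rewrite big_bool /= mulr0 addr0.
case: o => [[]|] /=.
- rewrite /stat_cost /w /pi0 /pi1; field; exact: pq0.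
- rewrite /stat_cost /w /pi0 /pi1; field; exact: pq0.
- by case: (x0 a) => /=; ring.
Qed.

(** Let the potential [Phi] be the sum over the arms of their Poisson solutions at the last
    observation. A play changes only the term of the played arm, so cost minus stationary cost,
    accumulated and added to [Phi], is a martingale. [Phi] takes finitely many values, hence the
    error is at most twice its bound [B], whatever the horizon. *)
Lemma ecost_arm_cost p01 p10 g : chains p01 p10 ->
  exists C : R, forall n,
    `|ecost p01 p10 (arm_cost g) noterm [::] n -
      \sum_(i < K) stat_cost p01 p10 g i * plays p01 p10 i n| <= C.
Proof.
move=> ch; have [phi phiP] := poisson_equation g ch.
pose Phi h := \sum_(a < K) phi a (last_obs h a).
pose B := \sum_(a < K) (`|phi a None| + `|phi a (Some true)| + `|phi a (Some false)|).
have PhiB h : `|Phi h| <= B.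
  apply: le_trans (ler_norm_sum _ _ _) _; apply: ler_sum => a _.
  have ? := normr_ge0 (phi a None); have ? := normr_ge0 (phi a (Some true)).
  have ? := normr_ge0 (phi a (Some false)).
  by case: (last_obs h a) => [[]|]; lra.
exists (B + B) => n.
rewrite -ecost_arm.
set E := ecost _ _ (arm_cost g) _ _ _.
set S := ecost _ _ (fun _ a _ => stat_cost _ _ _ a) _ _ _.
pose P := ecost p01 p10 nocost Phi [::] n.
have PB : `|P| <= B.
  rewrite ler_norml; apply/andP; split.
    rewrite -(ecost_cst p01 p10 (- B) [::] n); apply: ler_ecost => // h _.
    by have := PhiB h; rewrite ler_norml => /andP[].
  rewrite -(ecost_cst p01 p10 B [::] n); apply: ler_ecost => // h _.
  by have := PhiB h; rewrite ler_norml => /andP[].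
suff -> : E - S = Phi [::] - P.
  by apply: le_trans (ler_normB _ _) _; apply: lerD.
have Phi_rcons h a y :
    Phi (rcons h (a, y)) = Phi h - phi a (last_obs h a) + phi a (Some y).
  rewrite /Phi [LHS](bigD1 a) //= [in RHS](bigD1 a) //= last_obs_rcons eqxx.
  rewrite [in LHS](eq_bigr (fun b => phi b (last_obs h b))); first by ring.
  by move=> b /negPf ba; rewrite last_obs_rcons eq_sym ba.
have mart : ecost p01 p10 (fun h a y => arm_cost g h a y - stat_cost p01 p10 g a)
    Phi [::] n = Phi [::].
  apply: ecost_martingale => h a.
  transitivity (\sum_(y : bool) (arm_prob p01 p10 a (last_obs h a) y *
     (g a (last_obs h a) y + phi a (Some y)) + arm_prob p01 p10 a (last_obs h a) y *
     (Phi h - phi a (last_obs h a) - stat_cost p01 p10 g a))).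
    apply: eq_bigr => y _; rewrite -mulrDr /obs_prob; congr (_ * _).
    by rewrite /arm_cost Phi_rcons; ring.
  rewrite big_split /= phiP -mulr_suml arm_prob_sum; ring.
have := ecost_lin p01 p10 (-1) (fun _ a _ => stat_cost p01 p10 g a) noterm
  (arm_cost g) noterm [::] n.
have := ecost_lin p01 p10 1 (fun h a y => -1 * stat_cost p01 p10 g a + arm_cost g h a y)
  (fun h => -1 * noterm h + noterm h) nocost Phi [::] n.
rewrite (@eq_ecost _ _ _ (fun h a y => arm_cost g h a y - stat_cost p01 p10 g a) _ Phi).
- rewrite mart -/E -/S -/P => -> ->; ring.
- by move=> h a y; rewrite /nocost; ring.
- by move=> h; rewrite /noterm; ring.
Qed.

(** * Change of measure *)

Definition llr p01 p10 q01 q10 a o y : R :=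
  ln (arm_prob p01 p10 a o y / arm_prob q01 q10 a o y).

Definition abs_cont p01 p10 q01 q10 := forall a o y,
  0 < arm_prob p01 p10 a o y -> 0 < arm_prob q01 q10 a o y.

(* The free constant [k] absorbs the log-likelihood ratio collected so far. *)
Lemma change_of_measure p01 p10 q01 q10 F h m k :
    chains p01 p10 -> chains q01 q10 -> abs_cont p01 p10 q01 q10 ->
  ecost p01 p10 (fun h a y => - arm_cost (llr p01 p10 q01 q10) h a y) F h m <=
  k + expR (- k) * ecost q01 q10 nocost (fun h => expR (F h)) h m - 1.
Proof.
move=> chp chq ac; elim: m h k => [|m IH] h k /=.
  (* Without steps left, this is [1 + x <= expR x] at [x = F h - k]. *)
  have := expR_ge1Dx (F h - k); rewrite expRD mulrC; lra.
set L := arm_cost _.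
pose X h := ecost q01 q10 nocost (fun h => expR (F h)) h m.
have XP h' : 0 <= X h'.
  rewrite -(ecost0 q01 q10 h' m); apply: ler_ecost => // h'' _; exact: expR_ge0.
apply: (@le_trans _ _ (step p01 p10 h (fun a y =>
   (k - 1) + expR (- k) * (expR (- L h a y) * X (rcons h (a, y)))))).
  apply: ler_step => // a y; have := IH (rcons h (a, y)) (k + L h a y).
  by rewrite -/(X _) opprD expRD /L; lra.
rewrite [leLHS]stepD step_cst [X in _ + X]stepZ [leRHS]addrAC lerD2l.
apply: ler_wpM2l; first exact: expR_ge0.
apply: ler_step2 => a y; rewrite add0r mulrA.
apply: ler_wpM2r; first exact: XP.
rewrite /obs_prob -!/(arm_prob _ _ a (last_obs h a) y) /L /arm_cost /llr.
(* An observation impossible under the first law contributes 0 on the left. Elsewhere [expR (- L)]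
   is the ratio of the two probabilities and turns the first law into the second. *)
have := arm_prob_ge0 a (last_obs h a) y chp; rewrite le_eqVlt => /orP[/eqP<-|p0].
  by rewrite mul0r; exact: arm_prob_ge0.
have q0 := ac _ _ _ p0.
by rewrite expRN lnK ?posrE ?divr_gt0 // invf_div mulrC divfK // gt_eqF.
Qed.

Definition nplays i h : R := (count (fun x => x.1 == i) h)%:R.

Lemma nplays_rcons i h a y : nplays i (rcons h (a, y)) = nplays i h + (a == i)%:R.
Proof. by rewrite /nplays -cats1 count_cat natrD /= addn0. Qed.

(** The change of measure needs the number of plays inside an exponential, hence as a terminal cost.
    The count minus its running total is a martingale, which identifies the two expectations. *)
Lemma ecost_nplays p01 p10 i n u v :
  ecost p01 p10 nocost (fun h => u * nplays i h + v) [::] n =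
  u * plays p01 p10 i n + v.
Proof.
have mart : ecost p01 p10 (fun _ a _ => - (a == i)%:R) (nplays i) [::] n = 0.
  apply: ecost_martingale => h a.
  rewrite (eq_bigr (fun y => arm_prob p01 p10 a (last_obs h a) y * nplays i h)).
    by rewrite -mulr_suml arm_prob_sum mul1r.
  by move=> y _; rewrite nplays_rcons addrC addrK.
have playsE : plays p01 p10 i n = ecost p01 p10 nocost (nplays i) [::] n.
  apply/eqP; rewrite eq_sym -subr_eq0; apply/eqP; rewrite -[RHS]mart.
  rewrite -mulN1r addrC -ecost_lin; apply: eq_ecost => [h a y|h].
    by rewrite /nocost mulN1r addr0.
  by rewrite /noterm mulr0 add0r.
rewrite playsE -[X in _ = _ + X](ecost_cst p01 p10 v [::] n) -ecost_lin.
by apply: eq_ecost => [h' a y|//]; rewrite /nocost mulr0 addr0.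
Qed.


(** * Regret in terms of plays, and the trade-off between two bandits *)

Lemma plays_le p01 p10 i n : chains p01 p10 -> plays p01 p10 i n <= n%:R.
Proof.
move=> ch; rewrite -(sum_plays p01 p10) (bigD1 i) //= lerDl.
by apply: sumr_ge0 => j _; exact: plays_ge0.
Qed.

(** The stationary cost of the reward is the mean of the arm, and the numbers of plays add up to
    [n]. *)
Lemma regret_plays p01 p10 : chains p01 p10 ->
  exists C : R, forall n,
    `|regret p01 p10 x0 alpha n -
      \sum_(i < K) (mu_star p01 p10 - mu p01 p10 i) * plays p01 p10 i n| <= C.
Proof.
move=> ch; have [C CP] := ecost_arm_cost (fun _ _ y => (y : nat)%:R) ch.
exists C => n; rewrite distrC; move: (CP n).
rewrite /regret exp_rewardE -(sum_plays p01 p10) mulr_suml.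
congr (`| _ | <= _); rewrite opprB addrCA -sumrB; congr (_ + _).
rewrite -sumrN; apply: eq_bigr => i _.
suff -> : stat_cost p01 p10 (fun _ _ y => (y : nat)%:R) i = mu p01 p10 i by ring.
have [/andP[p0 _] /andP[q0 _]] := ch i.
rewrite /stat_cost /mean_cost !big_bool /= /mu /pi0 /pi1 /=.
by field; rewrite gt_eqF // addr_gt0.
Qed.

(** Convexity of the exponential: its tangent at [u * (1 - x)] lies below it at 0 and at [u], and
    these two bounds are averaged with weights [x] and [1 - x]. *)
Lemma expR_chord (u x : R) : 0 <= x <= 1 ->
  expR (u * (1 - x)) <= x + expR u * (1 - x).
Proof.
move=> /andP[x0' x1]; set z := expR _.
have z0 : 0 < z := expR_gt0 _.
have h1 : z * (1 - u * (1 - x)) <= 1.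
  rewrite -[leRHS](expRxMexpNx_1 (u * (1 - x))) ler_wpM2l ?(ltW z0) //.
  exact: expR_ge1Dx.
have h2 : z * (1 + u * x) <= expR u.
  rewrite (_ : expR u = z * expR (u * x)); last by rewrite -expRD; congr expR; ring.
  by rewrite ler_wpM2l ?(ltW z0) // expR_ge1Dx.
have := ler_wpM2l x0' h1; have : 0 <= 1 - x by lra.
move=> /ler_wpM2r /(_ _ _ h2); lra.
Qed.

(** The change of measure is applied to an affine function of the play count. The chord bound makes
    its exponential affine too, so that only expected numbers of plays remain. Arms with equal
    parameters have zero log-likelihood ratio, so the divergence is carried by arm [i] alone. *)
Lemma plays_tradeoff p01 p10 q01 q10 i :
    chains p01 p10 -> chains q01 q10 -> abs_cont p01 p10 q01 q10 ->
    (forall j, j != i -> p01 j = q01 j /\ p10 j = q10 j) ->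
  exists C : R, forall n u, (0 < n)%N ->
    u * (1 - plays p01 p10 i n / n%:R) <=
    stat_cost p01 p10 (llr p01 p10 q01 q10) i * plays p01 p10 i n + C +
    expR u * (1 - plays q01 q10 i n / n%:R).
Proof.
move=> chp chq ac eqpq.
have [C CP] := ecost_arm_cost (llr p01 p10 q01 q10) chp.
exists C => n u n0; have nR : 0 < n%:R :> R by rewrite ltr0n.
have := CP n; rewrite (bigD1 i) //= big1 ?addr0; last first.
  move=> j /eqpq[e1 e2]; rewrite (_ : stat_cost _ _ _ _ = 0) ?mul0r //.
  have llr0 o y : llr p01 p10 q01 q10 j o y = 0.
    have eqp : arm_prob q01 q10 j o y = arm_prob p01 p10 j o y.
      by case: o => [[]|] /=; rewrite ?e1 ?e2.
    rewrite /llr eqp; set v := arm_prob _ _ _ _ _.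
    (* An impossible observation gives the ratio 0 / 0 = 0, and [ln 0 = 0] by convention. *)
    by have [->|v0] := eqVneq v 0; [rewrite mul0r ln0|rewrite divff // ln1].
  by rewrite /stat_cost /mean_cost !big_bool !llr0 /= !mulr0 addr0 !mulr0 addr0.
rewrite ler_norml => /andP[_].
set S := stat_cost _ _ _ _; set E := ecost _ _ _ _ _ _ => ES.
pose F h := (- u / n%:R) * nplays i h + u.
have := change_of_measure F [::] n 0 chp chq ac.
have -> : ecost p01 p10 (fun h a y => - arm_cost (llr p01 p10 q01 q10) h a y) F [::] n =
   - E + u * (1 - plays p01 p10 i n / n%:R).
  rewrite /E (_ : u * _ = - u / n%:R * plays p01 p10 i n + u); last by ring.
  rewrite -ecost_nplays -[- ecost _ _ _ _ _ _]mulN1r -ecost_lin; apply: eq_ecost => [h a y|h].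
    by rewrite mulN1r addr0.
  by rewrite /noterm mulr0 add0r.
have : ecost q01 q10 nocost (fun h => expR (F h)) [::] n <=
    plays q01 q10 i n / n%:R + expR u * (1 - plays q01 q10 i n / n%:R).
  rewrite (_ : plays _ _ _ _ / _ + _ =
    (1 - expR u) / n%:R * plays q01 q10 i n + expR u); last by ring.
  rewrite -ecost_nplays; apply: ler_ecost => // h; rewrite add0n => hn.
  have := @expR_chord u (nplays i h / n%:R); rewrite /F.
  have -> : - u / n%:R * nplays i h + u = u * (1 - nplays i h / n%:R) by ring.
  have -> : (1 - expR u) / n%:R * nplays i h + expR u =
    nplays i h / n%:R + expR u * (1 - nplays i h / n%:R) by ring.
  apply; rewrite divr_ge0 ?ler0n // ler_pdivrMr // mul1r ler_nat -hn.
  exact: count_size.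
(* This share is cancelled by the [- 1] of the change of measure. *)
have : plays q01 q10 i n / n%:R <= 1 by rewrite ler_pdivrMr // mul1r plays_le.
rewrite oppr0 expR0 mul1r add0r; lra.
Qed.

End Expectation.

(** * Bernoulli divergence and its perturbation *)

Section Divergence.
Variable R : realType.
Implicit Types a b t : R.

Definition bern_kl a b : R := a * ln (a / b) + (1 - a) * ln ((1 - a) / (1 - b)).

Lemma klDE a b : 0 < a <= 1 -> 0 < b <= 1 ->
  klD a b = if (b == 1) && (a != 1) then +oo%E else (bern_kl a b)%:E.
Proof.
move=> /andP[a0 a1] /andP[b0 b1].
rewrite /klD /xlogxy /bern_kl gt_eqF // gt_eqF // !subr_eq0 ![1 == _]eq_sym.
have [->|_] := eqVneq a 1; first by rewrite andbF subrr mul0r !addr0.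
by have [_|_] := eqVneq b 1.
Qed.

(** Scaling [b] by [expR (- t)] adds exactly [t] to the first logarithm, whose weight [a] is at most
    1. It also raises [1 - b], which can only lower the second term. *)
Lemma bern_kl_expRN a b t : 0 < a <= 1 -> 0 < b <= 1 -> 0 < t ->
  (b = 1 -> a = 1) -> bern_kl a (b * expR (- t)) <= bern_kl a b + t.
Proof.
move=> /andP[a0 a1] /andP[b0 b1] t0 ba; rewrite /bern_kl.
have e0 := expR_gt0 (- t).
have e1 : expR (- t) < 1 by rewrite expR_lt1 oppr_lt0.
have -> : ln (a / (b * expR (- t))) = ln (a / b) + t.
  rewrite invfM mulrA lnM ?posrE ?divr_gt0 ?invr_gt0 //.
  by rewrite expRN invrK expRK.
have at1 : a * t <= t by rewrite ler_piMl // ltW.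
suff : (1 - a) * ln ((1 - a) / (1 - b * expR (- t))) <= (1 - a) * ln ((1 - a) / (1 - b)).
  by lra.
have [->|a1'] := eqVneq a 1; first by rewrite subrr !mul0r.
have b1' : b != 1 by apply: contra_neq a1' => /ba.
have la : 0 < 1 - a by rewrite subr_gt0 lt_neqAle a1'.
have lb : 0 < 1 - b by rewrite subr_gt0 lt_neqAle b1'.
have be : b * expR (- t) <= b by apply: ler_piMr; apply: ltW.
have lbe : 0 < 1 - b * expR (- t) by lra.
rewrite ler_pM2l // ler_ln ?posrE ?divr_gt0 // ler_pM2l // lef_pV2 ?posrE //.
by lra.
Qed.

End Divergence.

(** * The alternative bandit *)

Section Alternative.
Variables (R : realType) (K : nat) (x0 : 'I_K -> bool).
Variables (p01 p10 : 'I_K -> R) (i i1 : 'I_K).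
Hypothesis chp : chains p01 p10.

Lemma pi0_gt0 j : 0 < pi0 (p01 j) (p10 j).
Proof. by have [/andP[? _] /andP[? _]] := chp j; rewrite divr_gt0 ?addr_gt0. Qed.

Lemma pi1_gt0 j : 0 < pi1 (p01 j) (p10 j).
Proof. by have [/andP[? _] /andP[? _]] := chp j; rewrite divr_gt0 ?addr_gt0. Qed.

Lemma pi1_le1 j : pi1 (p01 j) (p10 j) <= 1.
Proof.
have [/andP[? _] /andP[? _]] := chp j.
by rewrite ler_pdivrMr ?addr_gt0 // mul1r lerDl ltW.
Qed.

(** Both stationary weights are positive, so an infinite divergence of either transition would make
    the sum infinite. *)
Lemma klI_fin r : klI p01 p10 i i1 = r%:E ->
  [/\ (p01 i1 = 1 -> p01 i = 1), (p10 i1 = 1 -> p10 i = 1) &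
   r = pi0 (p01 i) (p10 i) * bern_kl (p01 i) (p01 i1) +
       pi1 (p01 i) (p10 i) * bern_kl (p10 i) (p10 i1)].
Proof.
have [pi01 pi10] := chp i; have [pj01 pj10] := chp i1.
rewrite /klI !klDE //.
case: ifPn => [_|]; last case: ifPn => [_|].
- rewrite gt0_muley ?lte_fin ?pi0_gt0 //; case: ifPn => _ //.
  by rewrite gt0_muley ?lte_fin ?pi1_gt0.
- by rewrite gt0_muley ?lte_fin ?pi1_gt0.
- rewrite !negb_and !negbK => h1 h0 [<-]; split=> // e.
    by move: h0; rewrite e eqxx => /eqP.
  by move: h1; rewrite e eqxx => /eqP.
Qed.

(* Arm [i] is replaced by a slight improvement of arm [i1]: shrinking only p10
   keeps the divergence from arm [i] finite and makes arm [i] strictly optimal. *)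
Definition alt01 j : R := if j == i then p01 i1 else p01 j.
Definition alt10 t j : R := if j == i then p10 i1 * expR (- t) else p10 j.

Lemma alt10_ltr (t : R) : 0 < t -> 0 < p10 i1 * expR (- t) < p10 i1.
Proof.
move=> t0; have [_ /andP[q0 q1]] := chp i1.
by rewrite mulr_gt0 ?expR_gt0 // gtr_pMr // expR_lt1 oppr_lt0.
Qed.

Lemma chains_alt (t : R) : 0 < t -> chains alt01 (alt10 t).
Proof.
move=> t0 j; rewrite /alt01 /alt10; have := chp j; case: eqP => // _ _.
have [h /andP[q0 q1]] := chp i1; have /andP[? l] := alt10_ltr t0.
by split=> //; apply/andP; split=> //; apply: le_trans (ltW l) q1.
Qed.

Lemma mu_alt (t : R) : 0 < t -> mu p01 p10 i1 < mu alt01 (alt10 t) i.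
Proof.
move=> t0; have [/andP[p0 _] /andP[q0 _]] := chp i1.
have /andP[? l] := alt10_ltr t0.
rewrite /mu /pi1 /alt01 /alt10 eqxx ltr_pM2l // ltf_pV2 ?posrE ?addr_gt0 //.
by rewrite ltrD2l.
Qed.

Lemma mu_alt_neq t j : j != i -> mu alt01 (alt10 t) j = mu p01 p10 j.
Proof. by rewrite /mu /alt01 /alt10 => /negPf ->. Qed.

(** The altered [p10] lies strictly between 0 and 1, so the only transition of arm [i] that could
    vanish is from 0 to 0, when [p01 i1 = 1]. Finite divergence then forces [p01 i = 1]. *)
Lemma abs_cont_alt (r t : R) : klI p01 p10 i i1 = r%:E -> 0 < t ->
  abs_cont x0 p01 p10 alt01 (alt10 t).
Proof.
move=> /klI_fin[h1 h2 _] t0 a o y.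
have [/andP[p0 p1] /andP[q0 q1]] := chp i1; have /andP[e0 el] := alt10_ltr t0.
case: o => [s|//]; rewrite /arm_prob /alt01 /alt10; case: (eqVneq a i) => [->|//].
case: s; case: y => /=; rewrite ?subr_gt0 // => ?.
  exact: lt_le_trans el q1.
by rewrite lt_neqAle p1 andbT; apply: contraTneq isT => /h1; lra.
Qed.

Lemma stat_cost_alt (r t : R) : klI p01 p10 i i1 = r%:E -> 0 < t ->
  stat_cost x0 p01 p10 (llr x0 p01 p10 alt01 (alt10 t)) i <= r + t.
Proof.
move=> /klI_fin[h1 h2 ->] t0; have [pi01 pi10] := chp i; have [pj01 pj10] := chp i1.
have := bern_kl_expRN pi10 pj10 t0 h2.
rewrite -(ler_pM2l (pi1_gt0 i)).
have : pi1 (p01 i) (p10 i) * t <= t by rewrite ler_piMl ?pi1_le1 // ltW.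
have -> : stat_cost x0 p01 p10 (llr x0 p01 p10 alt01 (alt10 t)) i =
  pi0 (p01 i) (p10 i) * bern_kl (p01 i) (p01 i1) +
  pi1 (p01 i) (p10 i) * bern_kl (p10 i) (p10 i1 * expR (- t)).
  by rewrite /stat_cost /mean_cost !big_bool /llr /arm_prob /= /alt01 /alt10 eqxx /bern_kl;
    ring.
by lra.
Qed.

End Alternative.

(** * Asymptotic bounds on the numbers of plays *)

Section LowerBound.
Variables (R : realType) (K : nat) (x0 : 'I_K -> bool) (alpha : policy R K).
Variables (p01 p10 : 'I_K -> R) (i1 : 'I_K).
Hypothesis chp : chains p01 p10.
Hypothesis optimal : forall j, mu p01 p10 j <= mu p01 p10 i1.
Hypothesis alphaP : is_policy alpha.
Hypothesis good : uniformly_good x0 alpha.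

Lemma mu_starE q01 q10 (i : 'I_K) : @chains R K q01 q10 ->
  (forall j, mu q01 q10 j <= mu q01 q10 i) -> mu_star q01 q10 = mu q01 q10 i.
Proof.
move=> chq opt; apply/le_anti/andP; split; last first.
  exact: (le_bigmax 0 (mu q01 q10) i).
by apply: bigmax_le => [|j _]; [exact/ltW/pi1_gt0|exact: opt].
Qed.

Lemma near_regret_le q01 q10 (b e : R) : chains q01 q10 -> 0 < b -> 0 < e ->
  \forall n \near \oo%classic, regret q01 q10 x0 alpha n <= e * n%:R `^ b.
Proof.
move=> chq b0 e0; have := cvgr0_norm_lt _ (good chq b0) e e0.
move=> regret_small; near=> n.
have n0 : 0 < n%:R `^ b :> R.
  by rewrite powR_gt0 // ltr0n; near: n; exact: nbhs_infty_gt.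
rewrite -ler_pdivrMr //; apply: le_trans (ler_norm _) _.
by apply: ltW; near: n; exact: regret_small.
Unshelve. all: by end_near. Qed.

Lemma near_ln_ge (M : R) : \forall n \near \oo%classic, M <= ln n%:R.
Proof.
near=> n; have Mn : expR M <= n%:R by near: n; exact: nbhs_infty_ger.
by rewrite -(expRK M) ler_ln ?posrE ?expR_gt0 // (lt_le_trans (expR_gt0 M)).
Unshelve. all: by end_near. Qed.

Lemma near_plays_le i (b : R) : mu p01 p10 i < mu p01 p10 i1 -> 0 < b ->
  \forall n \near \oo%classic, plays x0 alpha p01 p10 i n <= b * n%:R.
Proof.
move=> subopt b0; set D := mu p01 p10 i1 - mu p01 p10 i.
have D0 : 0 < D by rewrite subr_gt0.
have [C CP] := regret_plays x0 alphaP chp.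
near=> n.
(* Uniform goodness is used with exponent 1. Half of [D * b * n] bounds the regret, the other half
   absorbs [C]. *)
have h1 : regret p01 p10 x0 alpha n <= D * b / 2 * n%:R `^ 1.
  by near: n; apply: near_regret_le => //; rewrite divr_gt0 ?mulr_gt0.
have h2 : C / (D * b / 2) <= n%:R by near: n; exact: nbhs_infty_ger.
move: h1 h2; rewrite powRr1 // ler_pdivrMr ?divr_gt0 ?mulr_gt0 // => h1 h2.
have := CP n; rewrite (mu_starE chp optimal) (bigD1 i) //= ler_norml => /andP[h3 _].
have : 0 <= \sum_(j < K | j != i)
    (mu p01 p10 i1 - mu p01 p10 j) * plays x0 alpha p01 p10 j n.
  by apply: sumr_ge0 => j _; rewrite mulr_ge0 ?plays_ge0 // subr_ge0.
move: h3; rewrite -/D; set S := \sum_(_ < _ | _) _ => h3 S0.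
rewrite -(ler_pM2l D0); move: h1 h2 h3.
rewrite [D * (b * _)]mulrA; set X := D * b; set T := D * _; lra.
Unshelve. all: by end_near. Qed.

(** In the alternative every play of an arm other than [i] costs at least the gap between [i] and
    the old optimum, so these plays are bounded by the regret. The additive error is absorbed
    because [n] to the power [b] is at least 1. *)
Lemma near_plays_alt i (t b : R) : 0 < t -> 0 < b ->
  exists D : R, \forall n \near \oo%classic,
    n%:R - plays x0 alpha (alt01 p01 i i1) (alt10 p10 i i1 t) i n <= D * n%:R `^ b.
Proof.
move=> t0 b0; set q01 := alt01 _ _ _; set q10 := alt10 _ _ _ _.
have chq : chains q01 q10 by exact: chains_alt.
have gap := mu_alt i i1 chp t0.
have gap0 : 0 < mu q01 q10 i - mu p01 p10 i1 by rewrite subr_gt0.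
have gap_le j : j != i -> mu q01 q10 i - mu p01 p10 i1 <= mu q01 q10 i - mu q01 q10 j.
  by move=> ji; rewrite lerD2l lerN2 mu_alt_neq.
have [C CP] := regret_plays x0 alphaP chq.
exists ((1 + `|C|) / (mu q01 q10 i - mu p01 p10 i1)); near=> n.
have nb1 : 1 <= n%:R `^ b :> R.
  rewrite -[leLHS](powRr0 n%:R) ler_powR ?(ltW b0) //.
  by near: n; exact: nbhs_infty_ger.
have h1 : regret q01 q10 x0 alpha n <= 1 * n%:R `^ b.
  by near: n; exact: near_regret_le.
rewrite mulrAC ler_pdivlMr //.
have := CP n; rewrite (mu_starE chq (i := i)); last first.
  move=> j; have [->//|ji] := eqVneq j i.
  by have := gap_le _ ji; have := gap; rewrite -/q01 -/q10; lra.
rewrite (bigD1 i) //= subrr mul0r add0r ler_norml => /andP[h2 _].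
have h3 : (n%:R - plays x0 alpha q01 q10 i n) * (mu q01 q10 i - mu p01 p10 i1) <=
    \sum_(j < K | j != i) (mu q01 q10 i - mu q01 q10 j) * plays x0 alpha q01 q10 j n.
  rewrite -(sum_plays x0 alphaP q01 q10 n) [X in (X - _) * _](bigD1 i) //= [X in X * _]addrAC subrr add0r mulr_suml.
  apply: ler_sum => j ji; rewrite mulrC ler_wpM2r ?plays_ge0 //.
  exact: gap_le.
have := ler_norm C; have : `|C| <= `|C| * n%:R `^ b by rewrite ler_peMr.
rewrite mulrDl; lra.
Unshelve. all: by end_near. Qed.

Lemma near_plays_ge i (r k : R) : mu p01 p10 i < mu p01 p10 i1 ->
  klI p01 p10 i i1 = r%:E -> 0 < r -> r < k ->
  \forall n \near \oo%classic, ln n%:R <= k * plays x0 alpha p01 p10 i n.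
Proof.
move=> subopt klr r0 rk; have k0 := lt_trans r0 rk.
(* These values make [r + t = k * (1 - 3 * b)]. The trade-off will yield [(1 - b) ^ 2 * ln n] on the
   left and constants at most [b * ln n] on the right, leaving at least [(1 - 3 * b) * ln n]; the
   factor [1 - 3 * b] then cancels. *)
pose t := (k - r) / 2; pose b := (k - r) / (6 * k).
have t0 : 0 < t by rewrite divr_gt0 ?subr_gt0.
have b0 : 0 < b by rewrite divr_gt0 ?subr_gt0 ?mulr_gt0.
have rtE : r + t = k * (1 - 3 * b) by rewrite /t /b; field; rewrite gt_eqF.
have b3 : 0 < 1 - 3 * b by rewrite -(pmulr_rgt0 _ k0) -rtE addr_gt0.
clearbody t b.
have [D DP] := near_plays_alt i t0 b0.
have [C CP] : exists C : R, forall n u, (0 < n)%N -> _ <= _ + C + _ :=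
  plays_tradeoff alphaP chp (chains_alt i i1 chp t0)
  (abs_cont_alt (x0 := x0) chp klr t0)
  (fun j ji => conj (esym (ifN_eq _ _ ji)) (esym (ifN_eq _ _ ji))).
near=> n.
have n0 : (0 < n)%N by near: n; exact: nbhs_infty_gt.
have nR : 0 < n%:R :> R by rewrite ltr0n.
have hD : n%:R - plays x0 alpha (alt01 p01 i i1) (alt10 p10 i i1 t) i n <=
  D * n%:R `^ b by near: n.
have hC : (C + D) / b <= ln n%:R by near: n; exact: near_ln_ge.
have ln0' : 0 <= ln n%:R :> R by near: n; exact: near_ln_ge.
have hb : plays x0 alpha p01 p10 i n <= b * n%:R.
  by near: n; exact: near_plays_le.
have T0 := plays_ge0 x0 alphaP i n chp.
(* With this [u], [expR u] is [n] divided by its power [b], just small enough for the alternative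
   term to stay below [D]. *)
have := CP n ((1 - b) * ln n%:R) n0.
have -> : expR ((1 - b) * ln n%:R) = n%:R / n%:R `^ b.
  rewrite mulrBl mul1r expRD lnK // expRN /powR gt_eqF //.
have nb0 : 0 < n%:R `^ b :> R by rewrite powR_gt0.
have : n%:R / n%:R `^ b *
    (1 - plays x0 alpha (alt01 p01 i i1) (alt10 p10 i i1 t) i n / n%:R) <= D.
  rewrite -(ler_pM2r nb0) (le_trans _ hD) // le_eqVlt; apply/orP; left; apply/eqP.
  by field; rewrite !gt_eqF.
have := ler_wpM2r T0 (stat_cost_alt x0 chp klr t0).
have : (1 - b) * ln n%:R * (1 - b) <=
    (1 - b) * ln n%:R * (1 - plays x0 alpha p01 p10 i n / n%:R).
  rewrite ler_wpM2l //; first by rewrite mulr_ge0 //; lra.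
  by rewrite lerD2l lerN2 ler_pdivrMr.
move: hC; rewrite ler_pdivrMr // rtE => hC.
have : 0 <= b * b * ln n%:R by rewrite mulr_ge0 // mulr_ge0 // ltW.
move=> hbb h1 h2 h3 h4.
rewrite -(ler_pM2l b3).
move: h1 h2 h3 h4; set S := stat_cost _ _ _ _ _ * _; set V := _ / _ * _.
set E := _ * (1 - plays _ _ _ _ _ _ / _); lra.
Unshelve. all: by end_near. Qed.

Lemma near_cost_ge i (e : R) : i != i1 -> 0 < e ->
  \forall n \near \oo%classic,
    (fine (kl_ratio (mu p01 p10 i1 - mu p01 p10 i) (klI p01 p10 i i1)) - e) * ln n%:R <=
    (mu p01 p10 i1 - mu p01 p10 i) * plays x0 alpha p01 p10 i n.
Proof.
move=> ii1 e0; set D := mu p01 p10 i1 - mu p01 p10 i.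
have D0 : 0 <= D by rewrite subr_ge0.
pose L := fine (kl_ratio D (klI p01 p10 i i1)) - e.
(* A nonpositive coefficient makes the claim trivial; this also disposes of zero gaps and of
   infinite divergences, where [kl_ratio] is 0. *)
have [L0|L0] := leP L 0.
  near=> n; apply: (@le_trans _ _ 0); last by rewrite mulr_ge0 ?plays_ge0.
  rewrite mulr_le0_ge0 //; near: n; exact: near_ln_ge.
move: L0; rewrite -/L; have [D_eq0|Dn0] := eqVneq D 0.
  by rewrite /L /kl_ratio D_eq0 eqxx /=; lra.
have Dp : 0 < D by rewrite lt_neqAle eq_sym Dn0.
rewrite /L /kl_ratio (negPf Dn0); case klr : (klI _ _ _ _) => [r||] /=; try lra.
(* Positivity of the divergence is read off from [D / r > e], without Gibbs' inequality. *)
move=> L0; have r0 : 0 < r.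
  rewrite -invr_gt0 -(pmulr_rgt0 _ Dp); lra.
(* This is the [k] for which [D / k] equals the wanted coefficient [D / r - e]. *)
have rk : r < D / (D / r - e).
  by rewrite ltr_pdivlMr // mulrBr mulrCA divff ?gt_eqF //; have := mulr_gt0 r0 e0; lra.
have subopt : mu p01 p10 i < mu p01 p10 i1 by rewrite -subr_gt0.
near=> n.
have : ln n%:R <= D / (D / r - e) * plays x0 alpha p01 p10 i n.
  by near: n; exact: near_plays_ge rk.
by rewrite mulrAC ler_pdivlMr // mulrC.
Unshelve. all: by end_near. Qed.

End LowerBound.

(** * Passage to the lower limit *)

Lemma limn_einf_ge (R : realType) (u : nat -> \bar R) (l : \bar R) :
  (\forall n \near \oo%classic, (l <= u n)%E) -> (l <= limn_einf u)%E.
Proof.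
move=> [N _ lu]; rewrite limn_einf_lim; apply: lime_ge; first exact: is_cvg_einfs.
exists N => // n /= Nn; apply/ereal_infP => _ [k /= nk <-].
by apply: lu => /=; exact: leq_trans nk.
Qed.

Theorem theorem3 (R : realType) (K : nat) (i1 : 'I_K)
    (p01 p10 : 'I_K -> R) (x0 : 'I_K -> bool) (alpha : policy R K) :
  (forall i, irreducible2 (p01 i) (p10 i)) ->
  (forall j, mu p01 p10 j <= mu p01 p10 i1) ->
  is_policy alpha ->
  uniformly_good x0 alpha ->
  let Delta := fun i => mu p01 p10 i1 - mu p01 p10 i in
  let rhs := (\sum_(i < K | i != i1) kl_ratio (Delta i) (klI p01 p10 i i1))%E in
  (rhs <= limn_einf (fun n : nat => (regret p01 p10 x0 alpha n / ln (n%:R))%:E))%E.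
Proof.
move=> chp optimal alphaP good; cbv zeta.
pose Delta i := mu p01 p10 i1 - mu p01 p10 i.
set rhs := (\sum_(i < K | _) _)%E.
pose L i := fine (kl_ratio (Delta i) (klI p01 p10 i i1)).
have rhsE : rhs = (\sum_(i < K | i != i1) L i)%:E.
  rewrite -sumEFin; apply: eq_bigr => i _; rewrite /L fineK // /kl_ratio.
  by case: ifP => //; case: (klI _ _ _ _).
have [C CP] := regret_plays x0 alphaP chp.
rewrite rhsE; apply/lee_subgt0Pr => e e0; apply: limn_einf_ge.
(* Half of [e] is shared among the arms; the other half, multiplied by [ln n], absorbs the constant
   [C] of the regret decomposition. *)
pose d := e / 2 / K%:R.
have K0 : 0 < K%:R :> R by rewrite ltr0n; exact: leq_ltn_trans (ltn_ord i1).
have d0 : 0 < d by rewrite !divr_gt0.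
have dsum : \sum_(i < K | i != i1) d <= e / 2.
  rewrite (@le_trans _ _ (\sum_(i < K) d)) //.
    by rewrite [leRHS](bigD1 i1) //= lerDr ltW.
  by rewrite sumr_const card_ord -[d *+ K]mulr_natr divfK // gt_eqF.
near=> n.
have ln_gt : 1 <= ln n%:R :> R by near: n; exact: near_ln_ge.
have lnC : C / (e / 2) <= ln n%:R by near: n; exact: near_ln_ge.
have costs : forall i, i != i1 ->
    (L i - d) * ln n%:R <= Delta i * plays x0 alpha p01 p10 i n.
  near: n; apply: filter_forall => i.
  have [->|ii1] := eqVneq i i1; first by near=> n.
  have := near_cost_ge chp optimal alphaP good ii1 d0.
  by apply: filterS => n hn _.
rewrite -EFinB lee_fin ler_pdivlMr ?(lt_le_trans ltr01) //.
have := CP n; rewrite (mu_starE chp optimal) (bigD1 i1) //= subrr mul0r add0r.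
rewrite ler_norml => /andP[h _].
have : (\sum_(i < K | i != i1) (L i - d)) * ln n%:R <=
    \sum_(i < K | i != i1) Delta i * plays x0 alpha p01 p10 i n.
  by rewrite mulr_suml; apply: ler_sum.
rewrite sumrB; move: lnC; rewrite ler_pdivrMr ?divr_gt0 // => lnC.
have := ler_wpM2r (le_trans ler01 ln_gt) dsum.
move: h; rewrite !mulrBl /Delta; lra.
Unshelve. all: by end_near. Qed.
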